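(* Let $1\le k<d\le n$. Let $D^{OMP}$ be the dictionary of size $d$ selected by the algorithm $\mathrm{SDS}_{\mathrm{OMP}}$, and let $D^*$ be an optimum dictionary, i.e. a set $D\subseteq V$ with $|D|\le d$ maximizing $F(D)$. Put $p=\frac{1}{\lambda_{\max}(C,k)}\bigl(1-e^{-\lambda_{\min}(C,2k)^2}\bigr)$. Then $$F(D^{OMP})\;\ge\;F(D^* )\cdot\frac{\gamma_{\emptyset,k}}{\lambda_{\max}(C,k)}\cdot\frac{1-e^{-p\,\gamma_{\emptyset,k}}}{d-d\,p\,\gamma_{\emptyset,k}+1}\;\ge\;F(D^* )\cdot\frac{\lambda_{\min}(C,k)}{\lambda_{\max}(C,k)}\cdot\frac{1-e^{-p\,\gamma_{\emptyset,k}}}{d-d\,p\,\gamma_{\emptyset,k}+1}.$$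
   Context: Setting: $Z_1,\dots,Z_s$ and $V=\{X_1,\dots,X_n\}$ are real random variables with mean $0$ and variance $1$. $C=(\mathrm{Cov}(X_i,X_{i'}))_{i,i'}$ is the covariance matrix of the $X_i$; for $S\subseteq V$ (identified with its index set), $C_S$ is the submatrix with rows and columns in $S$. It is assumed throughout that $C$, and hence every $C_S$, is non-singular. For a variable $Z$ and $S\subseteq V$, the squared multiple correlation is $R^2_{Z,S}=1-\min_{\alpha}E[(Z-\sum_{i\in S}\alpha_iX_i)^2]=\mathbf b_S^{T}C_S^{-1}\mathbf b_S$, where $\mathbf b_S=(\mathrm{Cov}(Z,X_i))_{i\in S}$ (and $R^2_{Z,\emptyset}=0$). The residual is $\mathrm{Res}(Z,S)=Z-\sum_{i\in S}\alpha_iX_i$ with $(\alpha_i)_{i\in S}=C_S^{-1}\mathbf b_S$. Dictionary selection objective: $F(D)=\sum_{j=1}^s\max_{S\subseteq D,|S|=k}R^2_{Z_j,S}$ for $D\subseteq V$ (when $|D|<k$, the maximum is over $S\subseteq D$ with $|S|\le k$). Orthogonal Matching Pursuit: $S_{OMP}(D,Z,k)$ denotes the set obtained by starting with $S_0=\emptyset$ and, in iteration $i+1$, choosing $X_m\in D\setminus S_i$ maximizing $|\mathrm{Cov}(\mathrm{Res}(Z,S_i),X_m)|$ (ties arbitrary), setting $S_{i+1}=S_i\cup\{X_m\}$, and stopping after $k$ iterations (or when $D$ is exhausted). $\mathrm{SDS}_{\mathrm{OMP}}$: start with $D_0=\emptyset$; in iteration $i+1$ choose $X_m\in V\setminus D_i$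 maximizing $\sum_{j=1}^sR^2_{Z_j,\,S_{OMP}(D_i\cup\{X_m\},Z_j,k)}$ (ties arbitrary) and set $D_{i+1}=D_i\cup\{X_m\}$; output $D_d$. Submodularity ratio with $U=\emptyset$: for a single target $Z$, it is $\min_{S\subseteq V,|S|\le k}\bigl(\sum_{i\in S}R^2_{Z,\{X_i\}}\bigr)/R^2_{Z,S}$, with the convention $0/0=1$; with several targets, $\gamma_{\emptyset,k}$ denotes the minimum of this quantity over $Z\in\{Z_1,\dots,Z_s\}$. Sparse eigenvalues: for $1\le m\le n$, $\lambda_{\min}(C,m)=\min_{|S|=m}\lambda_{\min}(C_S)$ and $\lambda_{\max}(C,m)=\max_{|S|=m}\lambda_{\max}(C_S)$, where $\lambda_{\min}(\cdot),\lambda_{\max}(\cdot)$ of a matrix are its smallest and largest eigenvalues; for $m>n$ put $\lambda_{\min}(C,m)=\lambda_{\min}(C)$. *)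

(* Defs.v *)
From HB Require Import structures.
From mathcomp Require Import all_boot all_order all_algebra.
From mathcomp Require Import all_classical all_reals all_analysis.

Set Implicit Arguments.
Unset Strict Implicit.
Unset Printing Implicit Defensive.

Import Order.TTheory GRing.Theory Num.Theory.
Import numFieldNormedType.Exports.

Local Open Scope classical_set_scope.
Local Open Scope ring_scope.

(* Minima and maxima are written inf and sup: for unit-variance variables with
   nonsingular covariance matrix, 1 <= m <= n and 0 < s, the sets involved are
   nonempty and the extrema are attained. *)

Section SparseEigenvalues.
Context {R : realType}.

Definition submx_set n (C : 'M[R]_n) (S : {set 'I_n}) : 'M[R]_#|S| :=
  mxsub enum_val enum_val C.

Definition lambda_min n (A : 'M[R]_n) : R := inf [set a | eigenvalue A a].

Definition lambda_max n (A : 'M[R]_n) : R := sup [set a | eigenvalue A a].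

(* For m > n there is no S with #|S| = m; lambda_min C is then the value. *)
Definition sparse_lambda_min n (C : 'M[R]_n) (m : nat) : R :=
  if (m <= n)%N then
    inf [set lambda_min (submx_set C S) | S in [set S : {set 'I_n} | #|S| = m]]
  else lambda_min C.

Definition sparse_lambda_max n (C : 'M[R]_n) (m : nat) : R :=
  sup [set lambda_max (submx_set C S) | S in [set S : {set 'I_n} | #|S| = m]].

End SparseEigenvalues.

Section Dictionary.
Context {disp : measure_display} {T : measurableType disp} {R : realType}.
Context (P : probability T R).

Definition standardized (Y : T -> R) : Prop :=
  [/\ Y \in Lfun P 2%:E, 'E_P[Y]%E = 0%E & 'V_P[Y]%E = 1%E].

Definition cov (Y Y' : T -> R) : R := fine (covariance P Y Y').

Context {n : nat} (X : 'I_n -> T -> R).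

Definition covmx : 'M[R]_n := \matrix_(i, j) cov (X i) (X j).

Definition covcol (Y : T -> R) (S : {set 'I_n}) : 'cV[R]_#|S| :=
  \col_i cov Y (X (enum_val i)).

Definition mean_sq_error (Y : T -> R) (S : {set 'I_n}) (a : 'I_n -> R) : R :=
  fine (expectation P (fun w => (Y w - \sum_(i in S) a i * X i w) ^+ 2)).

Definition Rsq (Y : T -> R) (S : {set 'I_n}) : R :=
  1 - inf (range (mean_sq_error Y S)).

Definition residual (Y : T -> R) (S : {set 'I_n}) : T -> R :=
  let a := invmx (submx_set covmx S) *m covcol Y S in
  fun w => Y w - \sum_(i < #|S|) a i 0 * X (enum_val i) w.

Definition omp_step (D : {set 'I_n}) (Y : T -> R) (S S' : {set 'I_n}) : Prop :=
  exists m, [/\ m \in D :\: S,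
    (forall m', m' \in D :\: S ->
       `|cov (residual Y S) (X m')| <= `|cov (residual Y S) (X m)|)
    & S' = m |: S].

(* S is a possible value of S_OMP(D, Y, k), ties being broken arbitrarily *)
Definition omp_output (D : {set 'I_n}) (Y : T -> R) (k : nat)
    (S : {set 'I_n}) : Prop :=
  exists Sq : nat -> {set 'I_n},
    [/\ Sq 0 = finset.set0,
        (forall i, (i < minn k #|D|)%N -> omp_step D Y (Sq i) (Sq i.+1))
      & S = Sq (minn k #|D|)].

Context {s : nat} (Z : 'I_s -> T -> R).

Definition selectable (k : nat) (D S : {set 'I_n}) : bool :=
  (S \subset D) && (if (k <= #|D|)%N then #|S| == k else (#|S| <= k)%N).

Definition F (k : nat) (D : {set 'I_n}) : R :=
  \sum_(j < s) sup [set Rsq (Z j) S | S in [set S | selectable k D S]].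

Definition optimal_dictionary (k d : nat) (D : {set 'I_n}) : Prop :=
  (#|D| <= d)%N /\
  (forall D' : {set 'I_n}, (#|D'| <= d)%N -> F k D' <= F k D).

Definition sds_omp_step (omp : {set 'I_n} -> 'I_s -> {set 'I_n})
    (D D' : {set 'I_n}) : Prop :=
  let value m := \sum_(j < s) Rsq (Z j) (omp (m |: D) j) in
  exists m, [/\ m \notin D,
    (forall m', m' \notin D -> value m' <= value m) & D' = m |: D].

(* D is a possible output of SDS_OMP. The results of the OMP calls are recorded
   in omp. Indexing them by the dictionary and the target only still allows
   arbitrary tie-breaking in each call: iteration i+1 makes one call for each
   set m |: D_i and each target, and these sets are distinct, of size i+1, so
   no call is made twice in a run. *)
Definition sds_omp_output (k d : nat) (D : {set 'I_n}) : Prop :=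
  exists (omp : {set 'I_n} -> 'I_s -> {set 'I_n}) (Dq : nat -> {set 'I_n}),
    [/\ (forall A j, omp_output A (Z j) k (omp A j)),
        Dq 0 = finset.set0,
        (forall i, (i < d)%N -> sds_omp_step omp (Dq i) (Dq i.+1))
      & D = Dq d].

Definition submod_ratio (Y : T -> R) (S : {set 'I_n}) : R :=
  let num := \sum_(i in S) Rsq Y (finset.set1 i) in
  let den := Rsq Y S in
  if (num == 0) && (den == 0) then 1 else num / den.

Definition gamma_target (Y : T -> R) (k : nat) : R :=
  inf [set submod_ratio Y S | S in [set S : {set 'I_n} | (#|S| <= k)%N]].

Definition gamma (k : nat) : R :=
  inf [set gamma_target (Z j) k | j in [set: 'I_s]].

End Dictionary.

(* Main.v *)
Require Import Defs.
From HB Require Import structures.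
From mathcomp Require Import all_boot all_order all_algebra.
From mathcomp Require Import all_classical all_reals all_analysis.
From mathcomp Require Import ring lra.
Import Order.TTheory GRing.Theory Num.Theory.
Import numFieldNormedType.Exports.
Local Open Scope ring_scope.

Set Implicit Arguments.
Unset Strict Implicit.
Unset Printing Implicit Defensive.

(* Write [F^(D)] for the sum over the targets of the largest sum of [k] squared
   covariances with variables of [D] ([top_weight]), [F~(D)] for the value of [D]
   under OMP, and [eta = 1 - exp (- lambda_min(C,2k)^2)]. Then
     [F^ <= lambda_max(C,k) F], [gamma F <= F^] and [eta F <= F~ <= F].
   Each OMP step reduces the distance to the best fit by a factor
   [1 - lambda_min(C,2k) / k], which gives the third estimate. So greedy selection
   for [F~] is approximately greedy for [F^]: with [x = p gamma], the dictionary
   [D'] following [D] satisfies [F^(D') >= x F^(m |: D)] for every [m].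
   As [F^] is monotone and submodular, summing over an optimal dictionary gives
   the recursion [d (F^(D') - x F^(D)) >= x (F^(Dopt) - F^(D))]. *)

(** * Quadratic forms and extreme eigenvalues *)

Section QuadraticForms.
Context {R : realType}.
Implicit Types (n : nat).

Definition dot n (u v : 'cV[R]_n) : R := \sum_i u i 0 * v i 0.

Lemma dotE n (u v : 'cV[R]_n) : dot u v = (u^T *m v) 0 0.
Proof. by rewrite mxE; apply: eq_bigr => i _; rewrite mxE. Qed.

Lemma dotC n (u v : 'cV[R]_n) : dot u v = dot v u.
Proof. by apply: eq_bigr => i _; rewrite mulrC. Qed.

Lemma dotDr n (u v w : 'cV[R]_n) : dot u (v + w) = dot u v + dot u w.
Proof. by rewrite !dotE mulmxDr mxE. Qed.

Lemma dotDl n (u v w : 'cV[R]_n) : dot (v + w) u = dot v u + dot w u.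
Proof. by rewrite !(dotC _ u) dotDr. Qed.

Lemma dotZr n a (u v : 'cV[R]_n) : dot u (a *: v) = a * dot u v.
Proof. by rewrite !dotE -scalemxAr mxE. Qed.

Lemma dotZl n a (u v : 'cV[R]_n) : dot (a *: u) v = a * dot u v.
Proof. by rewrite !(dotC _ v) dotZr. Qed.

Lemma dotNr n (u v : 'cV[R]_n) : dot u (- v) = - dot u v.
Proof. by rewrite -scaleN1r dotZr mulN1r. Qed.

Lemma dotBr n (u v w : 'cV[R]_n) : dot u (v - w) = dot u v - dot u w.
Proof. by rewrite dotDr dotNr. Qed.

Lemma dot_mulmx m n (A : 'M[R]_(m, n)) u v :
  dot u (A *m v) = dot (A^T *m u) v.
Proof. by rewrite !dotE trmx_mul trmxK mulmxA. Qed.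

Lemma dot_sym n (A : 'M[R]_n) (u v : 'cV_n) :
  A^T = A -> dot u (A *m v) = dot v (A *m u).
Proof. by move=> symA; rewrite dot_mulmx symA dotC. Qed.

Lemma dot_delta n (u : 'cV[R]_n) i : dot (delta_mx i 0) u = u i 0.
Proof.
rewrite /dot (bigD1 i)//= big1 ?addr0 => [|j ji]; first by rewrite mxE !eqxx mul1r.
by rewrite mxE (negbTE ji) mul0r.
Qed.

Lemma quad_delta n (A : 'M[R]_n) i :
  dot (delta_mx i 0) (A *m delta_mx i 0) = A i i.
Proof. by rewrite dot_delta -colE mxE. Qed.

Lemma dotuu_ge0 n (u : 'cV[R]_n) : 0 <= dot u u.
Proof. by apply: sumr_ge0 => i _; rewrite -expr2 sqr_ge0. Qed.

Lemma dotuu_eq0 n (u : 'cV[R]_n) : (dot u u == 0) = (u == 0).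
Proof.
apply/eqP/eqP => [u0|->]; last by rewrite /dot big1// => i _; rewrite mxE mul0r.
apply/matrixP => i j; rewrite ord1 mxE; apply/eqP; rewrite -sqrf_eq0 expr2.
have /psumr_eq0P -> // := u0.
by move=> k _; rewrite -expr2 sqr_ge0.
Qed.

Lemma dotuu_gt0 n (u : 'cV[R]_n) : u != 0 -> 0 < dot u u.
Proof. by move=> u0; rewrite lt_def dotuu_ge0 dotuu_eq0 u0. Qed.

Definition psd n (A : 'M[R]_n) := forall u, 0 <= dot u (A *m u).

Lemma quad_bounded n (A : 'M[R]_n) :
  exists2 K, 0 < K & forall u, `|dot u (A *m u)| <= K * dot u u.
Proof.
(* The summand 1 keeps the bound positive even for [A = 0], so that it can be inverted. The squares
   of [u i 0 - u j 0] and [u i 0 + u j 0] bound each product of entries by [dot u u]. *)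
exists (1 + \sum_i \sum_j `|A i j|) => [|u].
  rewrite ltr_pwDl// sumr_ge0// => i _; rewrite sumr_ge0//.
apply: (@le_trans _ _ ((\sum_i \sum_j `|A i j|) * dot u u)); last first.
  by rewrite ler_wpM2r ?dotuu_ge0// lerDr.
rewrite mulr_suml; apply: le_trans (ler_norm_sum _ _ _) _.
apply: ler_sum => i _; rewrite mxE mulr_sumr mulr_suml.
apply: le_trans (ler_norm_sum _ _ _) _; apply: ler_sum => j _.
rewrite mulrCA normrM ler_wpM2l//.
have le_dot k : u k 0 ^+ 2 <= dot u u.
  rewrite /dot (bigD1 k)//= expr2 lerDl sumr_ge0// => l _.
  by rewrite -expr2 sqr_ge0.
have := le_dot i; have := le_dot j; rewrite ler_norml.
have := sqr_ge0 (u i 0 - u j 0); have := sqr_ge0 (u i 0 + u j 0).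
rewrite sqrrB sqrrD => *; apply/andP; split; lra.
Qed.

(* Expanding [0 <= Q (u - t v)] at [v = A^-1 u], with [t] the inverse of a bound
   on the form of [A^-1]. *)
Lemma psd_unit_coercive n (A : 'M[R]_n) : A^T = A -> psd A -> A \in unitmx ->
  exists2 c, 0 < c & forall u, c * dot u u <= dot u (A *m u).
Proof.
move=> symA psdA uA; have [K K0 KP] := quad_bounded (invmx A).
exists K^-1; first by rewrite invr_gt0.
move=> u; pose v := invmx A *m u.
have := psdA (u + (- K^-1) *: v).
have Av : A *m v = u by rewrite mulKVmx.
rewrite mulmxDr -scalemxAr !dotDl !dotDr !dotZl !dotZr (dot_sym v u symA) Av.
rewrite (dotC v u).
have Kv : K^-1 * dot u v <= dot u u.
  by rewrite ler_pdivrMl//; exact: le_trans (ler_norm _) (KP u).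
have Ki0 : 0 <= K^-1 by rewrite invr_ge0 ltW.
have := ler_wpM2l Ki0 Kv.
lra.
Qed.

Lemma eigenvalue_quad n (A : 'M[R]_n) a : A^T = A -> eigenvalue A a ->
  exists2 u : 'cV_n, u != 0 & dot u (A *m u) = a * dot u u.
Proof.
move=> symA /eigenvalueP[v vA v0]; exists v^T; first by rewrite trmx_eq0.
by rewrite -{1}symA -trmx_mul vA linearZ/= dotZr.
Qed.

(* The infimum [m] of the Rayleigh quotients is an eigenvalue: otherwise [A - m]
   would be positive semidefinite and invertible, hence coercive. *)
Lemma lambda_min_le_quad n (A : 'M[R]_n) u : A^T = A ->
  lambda_min A * dot u u <= dot u (A *m u).
Proof.
move=> symA; have [->|u0] := eqVneq u 0.
  by rewrite mulmx0 /dot big1 ?mulr0// => i _; rewrite mxE mul0r.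
have [K K0 KP] := quad_bounded A.
pose E := [set r | exists2 v : 'cV[R]_n, v != 0 & r = dot v (A *m v) / dot v v]%classic.
have lbE r : E r -> - K <= r.
  move=> [v v0 ->]; rewrite ler_pdivlMr ?dotuu_gt0// mulNr.
  by have := KP v; rewrite ler_norml => /andP[].
have hlE : has_lbound E by exists (- K) => r /lbE.
have E0 : (E !=set0)%classic by exists (dot u (A *m u) / dot u u), u.
pose m := inf E.
have mP (v : 'cV_n) : m * dot v v <= dot v (A *m v).
  have [->|v0] := eqVneq v 0.
    by rewrite mulmx0 /dot big1 ?mulr0// => i _; rewrite mxE mul0r.
  by rewrite -ler_pdivlMr ?dotuu_gt0//; apply: ge_inf => //; exists v.
have quadB (v : 'cV_n) : dot v ((A - m%:M) *m v) = dot v (A *m v) - m * dot v v.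
  by rewrite mulmxBl dotBr mul_scalar_mx dotZr.
have nuB : A - m%:M \notin unitmx.
  apply/negP => uB; have [] := @psd_unit_coercive _ (A - m%:M) _ _ uB.
  - by rewrite linearB/= symA tr_scalar_mx.
  - by move=> v; rewrite quadB subr_ge0.
  move=> c c0 cP; suff: m + c <= m by lra.
  apply: lb_le_inf => // r [v v0 ->]; rewrite ler_pdivlMr ?dotuu_gt0//.
  by have := cP v; rewrite quadB; lra.
have eigm : eigenvalue A m.
  by rewrite /eigenvalue /eigenspace kermx_eq0 row_free_unit.
apply: le_trans (mP u); rewrite ler_wpM2r ?dotuu_ge0//; apply: ge_inf => //.
exists (- K) => a /(eigenvalue_quad symA)[v v0 va]; apply: lbE; exists v => //.
by rewrite va mulfK// dotuu_eq0.
Qed.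

(** Apply the lower bound to [- A]: as [inf] is minus the supremum of the negated set,
    [lambda_min (- A)] unfolds to [- lambda_max A]. *)
Lemma quad_le_lambda_max n (A : 'M[R]_n) u : A^T = A ->
  dot u (A *m u) <= lambda_max A * dot u u.
Proof.
move=> symA; have symN : (- A)^T = - A by rewrite linearN/= symA.
have := lambda_min_le_quad u symN; rewrite mulNmx dotNr /lambda_min /inf /lambda_max.
rewrite mulNr lerN2 (_ : (_ @` _)%classic = [set a | eigenvalue A a]%classic)//.
apply/seteqP; split => [a /= [b /eigenvalueP[v vA v0] <-]|a /= /eigenvalueP[v vA v0]].
  by apply/eigenvalueP; exists v => //; rewrite scaleNr -vA mulmxN opprK.
exists (- a); last by rewrite opprK.
by apply/eigenvalueP; exists v => //; rewrite mulmxN vA scaleNr.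
Qed.

Lemma lambda_min_ge0 n (A : 'M[R]_n) : A^T = A -> psd A -> 0 <= lambda_min A.
Proof.
move=> symA psdA; rewrite /lambda_min.
(* Without eigenvalues, as for the 0 by 0 matrix, the infimum is that of the empty set, which is 0
   by convention. *)
have [->|/set0P E0] := eqVneq [set a | eigenvalue A a]%classic set0.
  by rewrite inf0.
apply: lb_le_inf => // a /(eigenvalue_quad symA)[v v0 va].
by rewrite -(pmulr_lge0 _ (dotuu_gt0 v0)) -va.
Qed.

End QuadraticForms.

(** * Least squares on a subset of the variables *)

(** Sparse eigenvalues and [F] ask for sets of a prescribed size; smaller sets are padded by this
    lemma. *)
Lemma exists_superset_card (I : finType) (A D : {set I}) m :
    A \subset D -> (#|A| <= m <= #|D|)%N ->
  exists B : {set I}, [/\ A \subset B, B \subset D & #|B| = m].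
Proof.
move=> AD /andP[]; elim: m => [|m IH].
  by rewrite leqn0 => /eqP A0 _; exists A.
rewrite leq_eqVlt => /predU1P[Am _|Am mD]; first by exists A.
have [B [AB BD Bm]] := IH Am (ltnW mD).
have : B \proper D by rewrite finset.properEcard BD Bm.
case/properP => _ [x xD xB]; exists (x |: B); split.
- by rewrite (fintype.subset_trans AB)// finset.subsetUr.
- by rewrite finset.subUset finset.sub1set xD.
- by rewrite cardsU1 xB Bm.
Qed.

(** * Suprema and infima over a finite index type *)

Section FiniteExtrema.
Context {R : realType} {I : finType} (A : set I) (f : I -> R).

Lemma has_ubound_fin_image : has_ubound (f @` A)%classic.
Proof.
exists (\sum_i `|f i|) => _ [i _ <-]; rewrite (bigD1 i)//= (le_trans (ler_norm _))//.
by rewrite lerDl sumr_ge0.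
Qed.

Lemma has_lbound_fin_image : has_lbound (f @` A)%classic.
Proof.
exists (- \sum_i `|f i|) => _ [i _ <-]; rewrite lerNl (bigD1 i)//=.
by rewrite (le_trans (ler_norm _))// normrN lerDl sumr_ge0.
Qed.

Lemma le_sup_fin_image i : A i -> f i <= sup (f @` A)%classic.
Proof. by move=> Ai; apply: (ub_le_sup has_ubound_fin_image); exists i. Qed.

Lemma inf_fin_image_le i : A i -> inf (f @` A)%classic <= f i.
Proof. by move=> Ai; apply: (ge_inf has_lbound_fin_image); exists i. Qed.

Lemma sup_fin_image_le i0 M : A i0 -> (forall i, A i -> f i <= M) ->
  sup (f @` A)%classic <= M.
Proof.
move=> Ai0 fM; apply: ge_sup => [|_ [i Ai <-]]; last exact: fM.
by exists (f i0), i0.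
Qed.

Lemma le_inf_fin_image i0 M : A i0 -> (forall i, A i -> M <= f i) ->
  M <= inf (f @` A)%classic.
Proof.
move=> Ai0 fM; apply: lb_le_inf => [|_ [i Ai <-]]; last exact: fM.
by exists (f i0), i0.
Qed.

Lemma sup_fin_image_attained i0 : A i0 ->
  exists2 i, A i & sup (f @` A)%classic = f i.
Proof.
move=> /asboolP Ai0.
have [i /asboolP Ai imax] := @arg_maxP _ _ _ i0 (fun i => `[< A i >]) f Ai0.
exists i => //; apply/eqP; rewrite eq_le le_sup_fin_image// andbT.
by apply: sup_fin_image_le Ai _ => j /asboolP; exact: imax.
Qed.

End FiniteExtrema.

Section Regression.
Context {R : realType} {n : nat}.
Implicit Types (C : 'M[R]_n) (S : {set 'I_n}) (a b u v : 'cV[R]_n).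

Definition supported S a := forall i, i \notin S -> a i 0 = 0.

(** Multiplication by this matrix extends a vector indexed by [S] by zero, and its transpose
    restricts to [S]. Coefficient vectors for different sets thus live in one space. *)
Definition incl_mx S : 'M[R]_(n, #|S|) := \matrix_(i, l) (i == enum_val l)%:R.

Lemma incl_mx_trmul (m : nat) S (A : 'M[R]_(n, m)) l j :
  ((incl_mx S)^T *m A) l j = A (enum_val l) j.
Proof.
rewrite mxE (bigD1 (enum_val l))//= big1 ?addr0 => [|i il]; rewrite !mxE.
  by rewrite eqxx mul1r.
by rewrite (negbTE il) mul0r.
Qed.

Lemma mul_incl_mx (m : nat) S (A : 'M[R]_(m, n)) i l :
  (A *m incl_mx S) i l = A i (enum_val l).
Proof.
rewrite mxE (bigD1 (enum_val l))//= big1 ?addr0 => [|j jl]; rewrite !mxE.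
  by rewrite eqxx mulr1.
by rewrite (negbTE jl) mulr0.
Qed.

Lemma incl_mx_mul S (u : 'cV_#|S|) l : (incl_mx S *m u) (enum_val l) 0 = u l 0.
Proof.
rewrite mxE (bigD1 l)//= big1 ?addr0 => [|i il]; rewrite !mxE.
  by rewrite eqxx mul1r.
by rewrite (inj_eq enum_val_inj) eq_sym (negbTE il) mul0r.
Qed.

Lemma incl_mx_supported S (u : 'cV_#|S|) : supported S (incl_mx S *m u).
Proof.
move=> i iS; rewrite mxE big1// => l _; rewrite mxE.
have [il|_] := eqVneq; last by rewrite mul0r.
by rewrite il enum_valP in iS.
Qed.

Lemma supported_eq S u v : supported S u -> supported S v ->
  (forall i, i \in S -> u i 0 = v i 0) -> u = v.
Proof.
move=> uS vS uv; apply/matrixP => i j; rewrite ord1.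
by have [/uv//|iS] := boolP (i \in S); rewrite uS// vS.
Qed.

Lemma incl_mxK S u : supported S u -> incl_mx S *m ((incl_mx S)^T *m u) = u.
Proof.
move=> uS; apply: (@supported_eq S) => //; first exact: incl_mx_supported.
move=> i iS; rewrite -(enum_rankK_in iS iS) incl_mx_mul.
by rewrite incl_mx_trmul.
Qed.

Lemma submx_setE C S : submx_set C S = (incl_mx S)^T *m (C *m incl_mx S).
Proof.
by apply/matrixP => l l'; rewrite incl_mx_trmul mul_incl_mx mxE.
Qed.

Lemma quad_submx_set C S (u : 'cV_#|S|) :
  dot u (submx_set C S *m u) = dot (incl_mx S *m u) (C *m (incl_mx S *m u)).
Proof. by rewrite submx_setE -!mulmxA dot_mulmx trmxK. Qed.

Lemma dot_incl_mx S (u : 'cV_#|S|) : dot (incl_mx S *m u) (incl_mx S *m u) = dot u u.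
Proof.
rewrite dot_mulmx; congr dot; apply/matrixP => l j; rewrite ord1.
by rewrite incl_mx_trmul incl_mx_mul.
Qed.

Lemma submx_set_sym C S : C^T = C -> (submx_set C S)^T = submx_set C S.
Proof. by move=> symC; apply/matrixP => i j; rewrite !mxE -{1}symC mxE. Qed.

Lemma submx_set_psd C S : psd C -> psd (submx_set C S).
Proof. by move=> psdC u; rewrite quad_submx_set. Qed.

Lemma supportedS S S' u : S \subset S' -> supported S u -> supported S' u.
Proof.
move=> /fintype.subsetP SS' uS i iS'; apply: uS.
by apply: contra iS'; exact: SS'.
Qed.

Lemma supportedZ S t u : supported S u -> supported S (t *: u).
Proof. by move=> uS i iS; rewrite mxE uS ?mulr0. Qed.

Lemma supportedD S u v : supported S u -> supported S v -> supported S (u + v).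
Proof. by move=> uS vS i iS; rewrite mxE uS ?vS ?addr0. Qed.

Lemma supported_delta S i : i \in S -> supported S (delta_mx i 0).
Proof.
move=> iS j jS; rewrite mxE; have [ji|//] := eqVneq.
by rewrite ji iS in jS.
Qed.

(** With [b] the covariances of a unit-variance target, this is 1 minus the mean squared error of
    the combination with coefficients [a]. *)
Definition gain C b a : R := dot a b *+ 2 - dot a (C *m a).

(** The least-squares coefficients on [S], extended by zero. *)
Definition coef C b S : 'cV[R]_n :=
  incl_mx S *m (invmx (submx_set C S) *m ((incl_mx S)^T *m b)).

(** The squared multiple correlation in matrix form, see [RsqE]. *)
Definition fit C b S : R := gain C b (coef C b S).

Lemma coef_supported C b S : supported S (coef C b S).
Proof. exact: incl_mx_supported. Qed.

Section PositiveDefinite.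
Variables (C : 'M[R]_n).
Hypotheses (symC : C^T = C) (psdC : psd C) (unitC : C \in unitmx).

(** The form of the submatrix is that of [C] on vectors extended by zero, so it inherits coercivity
    and has no kernel. *)
Lemma submx_set_unit S : submx_set C S \in unitmx.
Proof.
have [c c0 cP] := psd_unit_coercive symC psdC unitC.
rewrite -row_free_unit -kermx_eq0; apply/rowV0P => v /sub_kermxP vA.
apply/eqP; rewrite -trmx_eq0 -dotuu_eq0 -dot_incl_mx.
rewrite eq_le dotuu_ge0 andbT -(pmulr_rle0 _ c0).
rewrite (le_trans (cP _))// -quad_submx_set -(submx_set_sym S symC) -trmx_mul vA.
by rewrite trmx0 /dot big1// => i _; rewrite !mxE mulr0.
Qed.

(** These are the normal equations of least squares. *)
Lemma resid_eq0 b S i : i \in S -> (b - C *m coef C b S) i 0 = 0.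
Proof.
move=> iS; rewrite -(enum_rankK_in iS iS) -incl_mx_trmul.
rewrite mulmxBr /coef !mulmxA -[_^T *m C *m _]mulmxA -submx_setE -!mulmxA mulKVmx.
  by rewrite subrr mxE.
exact: submx_set_unit.
Qed.

Lemma gain_coefD b S v : gain C b (coef C b S + v) =
  fit C b S + (dot v (b - C *m coef C b S) *+ 2 - dot v (C *m v)).
Proof.
rewrite /fit /gain mulmxDr dotDl !dotDl !dotDr dotNr (dot_sym _ _ symC).
by rewrite !mulr2n; ring.
Qed.

Lemma dot_supported S u v : supported S u -> (forall i, i \in S -> v i 0 = 0) ->
  dot u v = 0.
Proof.
move=> uS vS; rewrite /dot big1// => i _; have [/vS->|/uS->] := boolP (i \in S).
  by rewrite mulr0.
by rewrite mul0r.
Qed.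

(** Around [coef C b S] the linear term vanishes along displacements supported in [S], by the normal
    equations, and the quadratic term is nonpositive. *)
Lemma gain_le_fit b S a : supported S a -> gain C b a <= fit C b S.
Proof.
move=> aS; have -> : a = coef C b S + (a + (-1) *: coef C b S).
  by rewrite scaleN1r addrC subrK.
rewrite gain_coefD (@dot_supported S) ?mul0rn ?add0r ?gerDl ?oppr_le0//.
  by apply: supportedD => //; apply: supportedZ; exact: coef_supported.
by move=> i iS; rewrite resid_eq0.
Qed.

Lemma fit_ge0 b S : 0 <= fit C b S.
Proof.
apply: le_trans (@gain_le_fit b S 0 _); last by move=> i _; rewrite mxE.
by rewrite /gain mulmx0 !dotE trmx0 !mul0mx mxE mul0rn subr0.
Qed.

Lemma fit_mono b S S' : S \subset S' -> fit C b S <= fit C b S'.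
Proof.
by move=> SS'; apply: gain_le_fit; exact: (supportedS SS' (@coef_supported C b S)). Qed.

Lemma fit_set0 b : fit C b finset.set0 = 0.
Proof.
rewrite /fit (_ : coef _ _ _ = 0).
  by rewrite /gain mulmx0 !dotE trmx0 !mul0mx mxE mul0rn subr0.
apply/matrixP => i j; rewrite ord1 coef_supported ?mxE//.
by rewrite finset.in_set0.
Qed.

End PositiveDefinite.

Lemma sparse_lambda_min_le C m S u : C^T = C -> (#|S| <= m)%N -> supported S u ->
  sparse_lambda_min C m * dot u u <= dot u (C *m u).
Proof.
(* For [m > n] the value is [lambda_min C], which bounds the form on all vectors; otherwise [S] is
   padded to size [m]. *)
move=> symC Sm uS; rewrite /sparse_lambda_min; case: ifP => mn; last first.
  exact: lambda_min_le_quad.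
have [|B [SB _ Bm]] := @exists_superset_card _ S [set: 'I_n]%SET m (finset.subsetT _).
  by rewrite Sm cardsT card_ord.
rewrite -(incl_mxK (supportedS SB uS)) dot_incl_mx -quad_submx_set.
apply: le_trans (lambda_min_le_quad _ (submx_set_sym _ symC)).
by rewrite ler_wpM2r ?dotuu_ge0//; exact: inf_fin_image_le.
Qed.

Lemma quad_le_sparse_lambda_max C m S u : C^T = C -> (#|S| <= m <= n)%N ->
  supported S u -> dot u (C *m u) <= sparse_lambda_max C m * dot u u.
Proof.
move=> symC /andP[Sm mn] uS; rewrite /sparse_lambda_max.
have [|B [SB _ Bm]] := @exists_superset_card _ S [set: 'I_n]%SET m (finset.subsetT _).
  by rewrite Sm cardsT card_ord.
rewrite -(incl_mxK (supportedS SB uS)) dot_incl_mx -quad_submx_set.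
apply: le_trans (quad_le_lambda_max _ (submx_set_sym _ symC)) _.
rewrite ler_wpM2r ?dotuu_ge0//.
exact: (@le_sup_fin_image _ _ _ (fun S => lambda_max (submx_set C S))).
Qed.

Lemma sparse_lambda_min_ge0 C m : C^T = C -> psd C -> 0 <= sparse_lambda_min C m.
Proof.
move=> symC psdC; rewrite /sparse_lambda_min; case: ifP => mn;
  last exact: lambda_min_ge0.
have [|B [_ _ Bm]] :=
  @exists_superset_card _ finset.set0 [set: 'I_n]%SET m (finset.subsetT _).
  by rewrite cards0 cardsT card_ord.
apply: (@le_inf_fin_image _ _ _ _ B) => // S _.
by apply: lambda_min_ge0; [exact: submx_set_sym|exact: submx_set_psd].
Qed.

Lemma sparse_lambda_min_le_diag C m i : C^T = C -> (0 < m)%N ->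
  sparse_lambda_min C m <= C i i.
Proof.
move=> symC m0; have := @sparse_lambda_min_le C m [set i]%SET (delta_mx i 0) symC.
rewrite cards1 quad_delta dot_delta mxE !eqxx mulr1; apply => //.
by apply: supported_delta; rewrite finset.in_set1.
Qed.

Lemma diag_le_sparse_lambda_max C m i : C^T = C -> (0 < m <= n)%N ->
  C i i <= sparse_lambda_max C m.
Proof.
move=> symC m0; have := @quad_le_sparse_lambda_max C m [set i]%SET (delta_mx i 0) symC.
rewrite cards1 quad_delta dot_delta mxE !eqxx mulr1; apply => //.
by apply: supported_delta; rewrite finset.in_set1.
Qed.

End Regression.

(** * Orthogonal matching pursuit *)

Section SparseRegression.
Context {R : realType} {n : nat}.
Variables (C : 'M[R]_n).
Hypotheses (symC : C^T = C) (psdC : psd C) (unitC : C \in unitmx).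
Hypothesis (diagC : forall i, C i i = 1).
Implicit Types (S A D : {set 'I_n}) (a b : 'cV[R]_n).

(** By [fit_set1], the numerator of the submodularity ratio. *)
Definition weight b S : R := \sum_(i in S) b i 0 ^+ 2.

Lemma weight_ge0 b S : 0 <= weight b S.
Proof. by apply: sumr_ge0 => i _; exact: sqr_ge0. Qed.

(* Completing the square: [2 l a_i b_i - l^2 a_i^2 <= b_i^2]. *)
Lemma linear_quad_le_weight S a b l : supported S a ->
  l * (dot a b *+ 2 - l * dot a a) <= weight b S.
Proof.
move=> aS; rewrite /dot mulr_sumr -sumrMnl -sumrB mulr_sumr.
rewrite /weight [leRHS]big_mkcond/=; apply: ler_sum => i _.
case: ifPn => [_|/aS ->]; last by rewrite !mul0r mul0rn mulr0 subr0 mulr0.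
have := sqr_ge0 (b i 0 - l * a i 0); rewrite !mulr2n !expr2; lra.
Qed.

(** Complete the square at [a = coef C b S] with [l] the sparse eigenvalue:
    [l * dot a a <= dot a (C *m a)] makes the bracket at least the fit. *)
Lemma sparse_lambda_min_fit_le b S m : (#|S| <= m)%N ->
  sparse_lambda_min C m * fit C b S <= weight b S.
Proof.
move=> Sm; have cS := @coef_supported _ _ C b S.
apply: le_trans (linear_quad_le_weight b (sparse_lambda_min C m) cS).
rewrite ler_wpM2l ?sparse_lambda_min_ge0// lerB//.
exact: sparse_lambda_min_le cS.
Qed.

(** The test vector is [b] restricted to [S] and divided by [L]; with [w] the weight, its gain is at
    least [2 w / L - w / L]. *)
Lemma weight_le_sparse_lambda_max_fit b S m : (#|S| <= m <= n)%N ->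
  0 < sparse_lambda_max C m -> weight b S <= sparse_lambda_max C m * fit C b S.
Proof.
move=> Smn; set L := sparse_lambda_max C m => L0.
pose a : 'cV_n := \col_i (if i \in S then b i 0 else 0).
have aS : supported S a by move=> i /negbTE iS; rewrite mxE iS.
have ab : dot a b = weight b S.
  rewrite /weight big_mkcond/=; apply: eq_bigr => i _; rewrite mxE.
  by case: ifP; rewrite ?mul0r ?expr2.
have aa : dot a a = weight b S.
  rewrite /weight big_mkcond/=; apply: eq_bigr => i _; rewrite mxE.
  by case: ifP; rewrite ?mul0r ?expr2.
have := gain_le_fit symC psdC unitC b (supportedZ L^-1 aS).
rewrite /gain dotZl -scalemxAr dotZl dotZr ab.
have := quad_le_sparse_lambda_max symC Smn aS; rewrite aa -/L => Q g.
rewrite -ler_pdivrMl//; apply: le_trans g.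
have Li0 : 0 <= L^-1 by rewrite invr_ge0 ltW.
have : L^-1 * (L^-1 * dot a (C *m a)) <= L^-1 * (L^-1 * (L * weight b S)).
  by rewrite !ler_wpM2l.
rewrite mulKf ?gt_eqF// mulr2n; lra.
Qed.

(** Shifting coefficient [m] by its residual covariance [c] changes the gain by [2 c^2 - c^2],
    because [C m m = 1]. *)
Lemma fit_setU1_ge b S m :
  fit C b S + (b - C *m coef C b S) m 0 ^+ 2 <= fit C b (m |: S).
Proof.
set c := _ m 0; pose v : 'cV[R]_n := c *: delta_mx m 0.
have := @gain_le_fit _ _ C symC psdC unitC b (m |: S) (coef C b S + v).
rewrite gain_coefD// /v dotZl -scalemxAr dotZl dotZr dot_delta quad_delta diagC -/c.
rewrite mulr1 mulr2n addrK expr2; apply; apply: supportedD.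
  by apply: supportedS (@coef_supported _ _ C b S); exact: finset.subsetUr.
by apply: supportedZ; apply: supported_delta; exact: finset.setU11.
Qed.

Lemma fit_set1 b i : fit C b [set i]%SET = b i 0 ^+ 2.
Proof.
apply/eqP; rewrite eq_le; apply/andP; split; last first.
  have := fit_setU1_ge b finset.set0 i; rewrite finset.setU0 fit_set0// add0r.
  rewrite (_ : coef _ _ _ = 0) ?mulmx0 ?subr0//.
  by apply/matrixP => j l; rewrite ord1 coef_supported ?mxE// finset.in_set0.
set a := coef C b [set i]%SET.
have -> : fit C b [set i]%SET = gain C b (a i 0 *: delta_mx i 0).
  congr gain; apply: (@supported_eq _ _ [set i]%SET).
  - exact: coef_supported.
  - by apply: supportedZ; apply: supported_delta; rewrite finset.in_set1.
  - by move=> j /finset.set1P ->; rewrite !mxE !eqxx mulr1.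
rewrite /gain dotZl -scalemxAr dotZl dotZr dot_delta quad_delta diagC mulr1.
have := sqr_ge0 (b i 0 - a i 0); rewrite mulr2n !expr2; lra.
Qed.

(** Passing from [S] to [S :|: A] displaces the coefficients by [v] and gains [2 v.c - v.Cv], with
    [c] the residual covariances. The sparse eigenvalue bounds [v.Cv] from below, and completing the
    square leaves the weight of [c], which vanishes on [S]. *)
Lemma fit_gap_le b S A m : (#|S :|: A| <= m)%N ->
  sparse_lambda_min C m * (fit C b A - fit C b S) <=
  \sum_(i in A :\: S) (b - C *m coef C b S) i 0 ^+ 2.
Proof.
move=> SAm; set c := b - _.
pose v : 'cV[R]_n := coef C b (S :|: A) + (-1) *: coef C b S.
have vE : coef C b (S :|: A) = coef C b S + v by rewrite /v scaleN1r addrC subrK.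
have vS : supported (S :|: A) v.
  apply: supportedD; first exact: coef_supported.
  apply: supportedZ; apply: supportedS (@coef_supported _ _ C b S).
  exact: finset.subsetUl.
have cw : weight c (S :|: A) = \sum_(i in A :\: S) c i 0 ^+ 2.
  rewrite /weight (big_setID S)/= big1 ?add0r => [|i].
    by rewrite finset.setDUl finset.setDv finset.set0U.
  by rewrite finset.inE => /andP[_ iS]; rewrite resid_eq0// expr0n.
rewrite -cw; apply: le_trans (linear_quad_le_weight c (sparse_lambda_min C m) vS).
rewrite ler_wpM2l ?sparse_lambda_min_ge0//.
have : fit C b A <= fit C b (S :|: A).
  by apply: fit_mono => //; exact: finset.subsetUr.
rewrite [X in _ <= X]/fit vE gain_coefD// -/c.
have := sparse_lambda_min_le symC SAm vS; lra.
Qed.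

Section OMP.
Variables (b : 'cV[R]_n) (D : {set 'I_n}) (k : nat) (Sq : nat -> {set 'I_n}).
Hypotheses (k_gt0 : (0 < k)%N) (Sq0 : Sq 0 = finset.set0).
Hypothesis (SqS : forall i, (i < minn k #|D|)%N -> exists m,
  let c := b - C *m coef C b (Sq i) in
  [/\ m \in D :\: Sq i,
      (forall m', m' \in D :\: Sq i -> `|c m' 0| <= `|c m 0|)
    & Sq i.+1 = m |: Sq i]).

Lemma omp_run_sub_card i : (i <= minn k #|D|)%N -> Sq i \subset D /\ #|Sq i| = i.
Proof.
elim: i => [_|i IH ik]; first by rewrite Sq0 cards0 finset.sub0set.
have [SD Si] := IH (ltnW ik); have [m [mDS _ ->]] := SqS ik.
move: mDS; rewrite finset.inE => /andP[mS mD].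
by rewrite finset.subUset finset.sub1set mD SD cardsU1 mS Si.
Qed.

Lemma omp_run_guarantee A : A \subset D -> (#|A| <= k)%N ->
  (1 - expR (- sparse_lambda_min C (2 * k) ^+ 2)) * fit C b A <=
  fit C b (Sq (minn k #|D|)).
Proof.
move=> AD Ak; set l := sparse_lambda_min C (2 * k).
have fA0 : 0 <= fit C b A by exact: fit_ge0.
(* If [D] has fewer than [k] elements, the run exhausts it and attains the best fit on [D]. *)
have [kD|Dk] := leqP k #|D|; last first.
  have [SD cardS] := omp_run_sub_card (leqnn (minn k #|D|)).
  move: SD cardS; rewrite (minn_idPr (ltnW Dk)) => SD cardS.
  have -> : Sq #|D| = D by apply/eqP; rewrite finset.eqEcard SD cardS leqnn.
  apply: le_trans (fit_mono symC psdC unitC b AD).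
  by rewrite ler_piMl// gerBl expR_ge0.
have l0 : 0 <= l by exact: sparse_lambda_min_ge0.
have l1 : l <= 1.
  have /card_gt0P[i _] := leq_trans k_gt0 kD.
  by rewrite -(diagC i); apply: sparse_lambda_min_le_diag => //; rewrite muln_gt0.
have kR : 1 <= k%:R :> R by rewrite ler1n.
have k0 : 0 < k%:R :> R by rewrite ltr0n.
pose x := l / k%:R.
have x1 : 0 <= 1 - x by rewrite subr_ge0 ler_pdivrMr// mul1r (le_trans l1).
have gap i : (i <= k)%N -> fit C b A - fit C b (Sq i) <= (1 - x) ^+ i * fit C b A.
  elim: i => [_|i IH ik]; first by rewrite expr0 mul1r gerBl fit_ge0.
  have ik' : (i < minn k #|D|)%N by rewrite (minn_idPl kD).
  have [SD Si] := omp_run_sub_card (ltnW ik').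
  have [m /= [mDS mmax Sm]] := SqS ik'.
  rewrite exprS -mulrA; apply: le_trans (ler_wpM2l x1 (IH (ltnW ik))).
  have : l * (fit C b A - fit C b (Sq i)) <=
      k%:R * (fit C b (Sq i.+1) - fit C b (Sq i)).
    (* The sparsity [2k] comes from the union of [Sq i] and [A], each of size at most [k]. *)
    apply: le_trans (fit_gap_le b (m := (2 * k)%N) _) _.
      by rewrite (leq_trans (leq_card_setU _ _))// Si mul2n -addnn leq_add// ltnW.
    set c := b - _.
    (* By the greedy choice of [m], each of the at most [k] terms is bounded by [c m 0 ^+ 2]. *)
    apply: (@le_trans _ _ (\sum_(j in A :\: Sq i) c m 0 ^+ 2)).
      apply: ler_sum => j; rewrite finset.inE => /andP[jS jA].
      rewrite -[leLHS]real_normK ?num_real// -[leRHS]real_normK ?num_real//.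
      rewrite lerXn2r ?nnegrE//; apply: mmax.
      by rewrite finset.inE jS (fintype.subsetP AD).
    rewrite sumr_const -[_ *+ #|_|]mulr_natl.
    apply: (@le_trans _ _ (k%:R * c m 0 ^+ 2)).
      rewrite ler_wpM2r ?sqr_ge0// ler_nat (leq_trans _ Ak)//.
      by rewrite subset_leq_card// finset.subsetDl.
    by rewrite ler_wpM2l ?ler0n// lerBrDl Sm; exact: fit_setU1_ge.
  rewrite -ler_pdivrMl// mulrA [_^-1 * l]mulrC -/x; lra.
have := gap k (leqnn k).
(* The power is at most [exp (- l)], and [l <= 1] lets this be weakened to [exp (- l^2)]. *)
have : (1 - x) ^+ k <= expR (- l ^+ 2).
  apply: (@le_trans _ _ (expR (- x) ^+ k)).
    by rewrite lerXn2r ?nnegrE ?expR_ge0//; exact: expR_ge1Dx.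
  rewrite -expRM_natr ler_expR mulNr lerN2 /x divfK ?gt_eqF//.
  by rewrite expr2 ler_piMr.
move=> /(ler_wpM2r fA0); lra.
Qed.

End OMP.
End SparseRegression.

(** * Submodularity and the greedy recursion *)

Section HeaviestSubset.
Context {R : realType} {I : finType}.
Variables (w : I -> R) (k : nat).
Hypotheses (w_ge0 : forall i, 0 <= w i) (k_gt0 : (0 < k)%N).
Implicit Types (A B D E : {set I}).

Definition subset_le D : set {set I} :=
  [set A : {set I} | (A \subset D) && (#|A| <= k)%N]%classic.

Definition heaviest D : R :=
  sup [set \sum_(i in A) w i | A in subset_le D]%classic.

Lemma subset_le_set0 D : subset_le D finset.set0.
Proof. by rewrite /subset_le/= finset.sub0set cards0. Qed.

Lemma le_heaviest D A : A \subset D -> (#|A| <= k)%N ->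
  \sum_(i in A) w i <= heaviest D.
Proof.
move=> AD Ak; apply: (@le_sup_fin_image _ _ _ (fun A => \sum_(i in A) w i)).
by rewrite /subset_le/= AD Ak.
Qed.

Lemma heaviest_attained D : exists A : {set I},
  [/\ A \subset D, (#|A| <= k)%N & heaviest D = \sum_(i in A) w i].
Proof.
have [A /andP[AD Ak] hA] := sup_fin_image_attained (fun A => \sum_(i in A) w i)
  (subset_le_set0 D).
by exists A.
Qed.

Lemma heaviest_ge0 D : 0 <= heaviest D.
Proof.
by apply: le_trans (le_heaviest (finset.sub0set D) _); rewrite ?big_set0 ?cards0.
Qed.

Lemma heaviest_mono D E : D \subset E -> heaviest D <= heaviest E.
Proof.
move=> DE; have [A [AD Ak ->]] := heaviest_attained D.
by apply: le_heaviest => //; exact: fintype.subset_trans DE.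
Qed.

(* [t] is the weight displaced from [A] by a new element: the least weight of [A]
   when [A] is full, and 0 otherwise. *)
Lemma heaviest_exchange D A : A \subset D -> (#|A| <= k)%N ->
  exists t, [/\ 0 <= t,
    (forall B : {set I}, (#|B| <= k)%N ->
       t * #|B :\: A|%:R <= \sum_(i in A :\: B) w i)
    & forall m, m \notin A -> \sum_(i in A) w i + w m - t <= heaviest (m |: D)].
Proof.
move=> AD; rewrite leq_eqVlt => /predU1P[Ak|Ak]; last first.
  exists 0; split => // [B _|m mA]; first by rewrite mul0r sumr_ge0.
  rewrite subr0 addrC -big_setU1//=; apply: le_heaviest; last by rewrite cardsU1 mA.
  exact: finset.setUS.
have /card_gt0P[a0 a0A] : (0 < #|A|)%N by rewrite Ak.
have [a /= aA amin] := @arg_minP _ _ _ a0 (fun i => i \in A) w a0A.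
exists (w a); split => // [B Bk|m mA].
  apply: (@le_trans _ _ (w a * #|A :\: B|%:R)).
    (* As [B] is no larger than the full set [A], the difference [B :\: A] is no larger than
       [A :\: B]. *)
    rewrite ler_wpM2l// ler_nat -(leq_add2l #|A :&: B|) cardsID.
    by rewrite finset.setIC cardsID Ak.
  rewrite mulr_natr -sumr_const; apply: ler_sum => i.
  by rewrite finset.inE => /andP[_ /amin].
rewrite (big_setD1 a)//= [w a + _]addrC addrAC addrK addrC.
have mAa : m \notin A :\ a by rewrite !finset.inE (negbTE mA) andbF.
rewrite -big_setU1//=; apply: le_heaviest.
  by rewrite finset.setUS// (fintype.subset_trans _ AD)// finset.subsetDl.
by rewrite cardsU1 mAa -Ak [X in (_ <= X)%N](cardsD1 a) aA.
Qed.

(** Let [A] and [B] be heaviest for [D] and [E]. Each element of [B :\: A] alone gains at least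
    [w m - t] over [A], and the weight of [A :\: B] pays for all the displaced copies of [t]. *)
Lemma heaviest_gap D E :
  heaviest E - heaviest D <= \sum_(m in E) (heaviest (m |: D) - heaviest D).
Proof.
have [A [AD Ak hA]] := heaviest_attained D.
have [B [BE Bk hB]] := heaviest_attained E.
have [t [t0 tB tA]] := heaviest_exchange AD Ak.
have inc_ge0 m : 0 <= heaviest (m |: D) - heaviest D.
  by rewrite subr_ge0 heaviest_mono// finset.subsetUr.
apply: (@le_trans _ _ (\sum_(m in B :\: A) (heaviest (m |: D) - heaviest D))).
  apply: (@le_trans _ _ (\sum_(m in B :\: A) (w m - t))).
    rewrite sumrB sumr_const -[t *+ _]mulr_natr hB hA.
    rewrite [X in X - _ <= _](big_setID A)/= [X in _ - X <= _](big_setID B)/=.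
    by rewrite finset.setIC; have := tB _ Bk; lra.
  apply: ler_sum => m; rewrite finset.inE => /andP[mA _].
  by have := tA _ mA; rewrite hA; lra.
rewrite [leRHS](big_setID (B :\: A))/= (finset.setIidPr _).
  by rewrite lerDl sumr_ge0.
by rewrite (fintype.subset_trans _ BE)// finset.subsetDl.
Qed.

End HeaviestSubset.

Section Recursion.
Context {R : realType}.
Implicit Types (x T : R) (f : nat -> R).

Lemma expR1_ge : 5 / 2 <= expR 1 :> R.
Proof.
(* The bound [1 + t <= exp t] is taken at [t = 1/8] and raised to the eighth power. *)
have -> : 1 = 8%:R * (8^-1) :> R by lra.
rewrite expRM_natl; apply: (@le_trans _ _ ((1 + 8^-1) ^+ 8)); first by lra.
by rewrite lerXn2r ?nnegrE ?expR_ge0 ?expR_ge1Dx//; lra.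
Qed.

Lemma expR1_le : expR 1 <= 3 :> R.
Proof.
have : 3^-1 <= expR (-1) :> R.
  have -> : -1 = 8%:R * (- 8^-1) :> R by lra.
  rewrite expRM_natl; apply: (@le_trans _ _ ((1 - 8^-1) ^+ 8)); first by lra.
  by rewrite lerXn2r ?nnegrE ?expR_ge0 ?expR_ge1Dx//; lra.
by rewrite expRN lef_pV2 ?posrE ?expR_gt0//; lra.
Qed.

(* Equality holds at 0 and 1, so two bounds are needed: the square of
   [1 - x / 2 <= exp (- x / 2)] near 0 and [2 - x <= exp (1 - x)] near 1. *)
Lemma expRN_cubic x : 0 <= x <= 1 -> 1 - x + x ^+ 3 * expR (-1) <= expR (- x).
Proof.
move=> /andP[x0 x1]; have e_ge := expR1_ge; have e_le := expR1_le.
have e0 : 0 < expR 1 :> R by exact: expR_gt0.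
(* Near 0, with [exp (-1) <= 2/5], the claim needs [2 x / 5 <= 1/4], that is [x <= 5/8]. Near 1, as
   [2 - x - x^3 = (1 - x) (2 + x + x^2)], it needs [exp 1 <= 2 + x + x^2], and the right side
   exceeds 3 from 5/8 on. *)
have [x58|x58] := leP x (5 / 8).
  have -> : - x = 2%:R * (- (x / 2)) by lra.
  rewrite expRM_natl; apply: (@le_trans _ _ ((1 - x / 2) ^+ 2)); last first.
    by rewrite lerXn2r ?nnegrE ?expR_ge0 ?expR_ge1Dx//; lra.
  have eN : expR (-1) <= 2 / 5 :> R by rewrite expRN invf_ple ?posrE//; lra.
  have x3 : 0 <= x ^+ 3 by rewrite exprn_ge0.
  have := ler_wpM2l x3 eN.
  have : x ^+ 2 * x <= x ^+ 2 * (5 / 8) by rewrite ler_wpM2l ?sqr_ge0.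
  rewrite -exprSr; lra.
have -> : - x = -1 + (1 - x) by lra.
rewrite expRD -(ler_pM2l e0) mulrA -expRD subrr expR0 mul1r.
rewrite mulrDr mulrCA -expRD subrr expR0 mulr1.
apply: le_trans (expR_ge1Dx (1 - x)).
have : (1 - x) * expR 1 <= (1 - x) * (2 + x + x ^+ 2).
  have : 5 / 8 * x <= x * x by rewrite ler_wpM2r// ltW.
  by move=> xx; rewrite ler_wpM2l ?expr2//; lra.
rewrite [expR 1 * _]mulrC !exprS expr0; lra.
Qed.

(** Converts the closed form of the recursion into an exponential: [x^d <= x^2] and
    [(1 - 1/d)^d <= exp (-1)] reduce it to the cubic bound. *)
Lemma one_minus_expRN_le d x : (2 <= d)%N -> 0 <= x <= 1 ->
  1 - expR (- x) <= x * (1 - (x * (1 - d%:R^-1)) ^+ d).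
Proof.
move=> d2 x01; have /andP[x0 x1] := x01; have := expRN_cubic x01.
have d0 : 0 < d%:R :> R by rewrite ltr0n (leq_trans _ d2).
have di1 : d%:R^-1 <= 1 :> R by rewrite invf_le1// ler1n (leq_trans _ d2).
have : (1 - d%:R^-1) ^+ d <= expR (-1) :> R.
  have -> : -1 = - d%:R^-1 * d%:R :> R by rewrite mulNr mulVf ?gt_eqF.
  rewrite expRM_natr.
  by rewrite lerXn2r ?nnegrE ?expR_ge0 ?expR_ge1Dx//; lra.
rewrite exprMn.
have : x ^+ d <= x ^+ 2 by rewrite ler_wiXn2l.
have : 0 <= (1 - d%:R^-1) ^+ d :> R by rewrite exprn_ge0// subr_ge0.
set u := _ ^+ d; set y := x ^+ d => u0 yx ue.
have : x * (y * u) <= x * (x ^+ 2 * expR (-1)).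
  by rewrite ler_wpM2l// ler_pM// exprn_ge0.
rewrite (mulrA x (x ^+ 2)) -exprS; lra.
Qed.

(** The recursion reads [f (i+1) >= x T / d + c f i] with [c = x (1 - 1/d)]. Its fixed point is
    [x T / (d - d x + x)], approached at rate [c], which gives the invariant [frec']. *)
Lemma greedy_recursion d x T f : (2 <= d)%N -> 0 <= x <= 1 -> 0 <= T ->
    0 <= f 0 ->
    (forall i, (i < d)%N -> x * (T - f i) <= d%:R * (f i.+1 - x * f i)) ->
  T * ((1 - expR (- x)) / (d%:R - d%:R * x + 1)) <= f d.
Proof.
move=> d2 x01 T0 f0 frec; have /andP[x0 x1] := x01.
have d0 : 0 < d%:R :> R by rewrite ltr0n (leq_trans _ d2).
have dx : 0 <= d%:R - d%:R * x.
  by rewrite -[X in X - _]mulr1 -mulrBr mulr_ge0 ?subr_ge0// ltW.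
have di1 : d%:R^-1 <= 1 :> R by rewrite invf_le1// ler1n (leq_trans _ d2).
pose c := x * (1 - d%:R^-1).
have c0 : 0 <= c by rewrite mulr_ge0// subr_ge0.
have dc : d%:R * c = d%:R * x - x.
  by rewrite /c mulrCA mulrBr mulr1 divff ?gt_eqF// mulrBr mulr1 [x * d%:R]mulrC.
have frec' i : (i <= d)%N -> x * T * (1 - c ^+ i) <= (d%:R - d%:R * x + x) * f i.
  elim: i => [_|i IH id]; first by rewrite expr0 subrr mulr0 mulr_ge0// addr_ge0.
  have dxx : 0 <= d%:R - d%:R * x + x by rewrite addr_ge0.
  have h2 := ler_wpM2l dxx (frec i id).
  rewrite -(ler_pM2l d0) exprS; move: h2.
  set y := c ^+ i; set g := f i; set h := f i.+1 => h2.
  have h3 : 0 <= d%:R * c by rewrite mulr_ge0// ltW.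
  have := ler_wpM2l h3 (IH (ltnW id)).
  have -> : d%:R * (x * T * (1 - c * y)) =
    d%:R * x * T - d%:R * c * (x * T * y) by ring.
  by rewrite -/g -/y dc; lra.
have h1 := one_minus_expRN_le d2 x01; have h2 := frec' d (leqnn d).
have h3 : T * (1 - expR (- x)) <= (d%:R - d%:R * x + x) * f d.
  apply: le_trans h2; rewrite [x * T]mulrC -mulrA.
  exact: ler_wpM2l.
(* A positive denominator makes [f d] nonnegative, so the summand [x] may be enlarged to 1. *)
have D1 : 1 <= d%:R - d%:R * x + x.
  have : 1 * (1 - x) <= d%:R * (1 - x).
    by rewrite ler_wpM2r ?subr_ge0// ler1n (leq_trans _ d2).
  lra.
have fd : 0 <= f d.
  rewrite -(pmulr_rge0 _ (lt_le_trans ltr01 D1)); apply: le_trans h3.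
  by rewrite mulr_ge0// subr_ge0 expRN invf_le1 ?expR_gt0// -[leLHS]expR0 ler_expR.
rewrite mulrA ler_pdivrMr ?ltr_wpDl//; apply: le_trans h3 _.
by rewrite mulrC ler_wpM2l// lerD2l.
Qed.
End Recursion.

(** * Covariances *)

Section Covariance.
Context {disp : measure_display} {T : measurableType disp} {R : realType}.
Context (P : probability T R).
Implicit Types (U V W Y : T -> R).

(** Unlike [standardized], this class is closed under linear combinations, hence contains the
    residuals. *)
Definition centered Y : Prop := Y \in Lfun P 2%:E /\ 'E_P[Y]%E = 0%E.

Lemma centered_Lfun1 Y : centered Y -> Y \in Lfun P 1.
Proof. by case=> Y2 _; apply: Lfun_subset12 Y2; exact: fin_num_measure. Qed.

Lemma standardized_centered Y : standardized P Y -> centered Y.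
Proof. by case. Qed.

Lemma standardized_cov Y : standardized P Y -> cov P Y Y = 1.
Proof. by case=> _ _ V1; rewrite /cov -/(variance _ _) V1. Qed.

Lemma centeredD U V : centered U -> centered V -> centered (fun w => U w + V w).
Proof.
move=> cU cV; have [U2 U0] := cU; have [V2 V0] := cV; split.
  by apply: rpredD U2 V2; rewrite lee1n.
by rewrite -[fun w => _]/(U \+ V) expectationD ?centered_Lfun1// U0 V0 adde0.
Qed.

Lemma scale_funE a U : (fun w => a * U w) = a \o* U.
Proof. by apply/funext => w; rewrite /= mulrC. Qed.

Lemma centeredZ a U : centered U -> centered (fun w => a * U w).
Proof.
move=> cU; have [U2 U0] := cU; rewrite scale_funE; split.
  by apply: Lfun_scale => //; rewrite ler1n.
by rewrite expectationZl ?centered_Lfun1// U0 mule0.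
Qed.

Lemma centered0 : centered (fun=> 0).
Proof. by split; [exact: Lfun_cst|exact: expectation_cst]. Qed.

Lemma centered_sum I (r : seq I) (Q : pred I) (a : I -> R) (W : I -> T -> R) :
  (forall i, centered (W i)) -> centered (fun w => \sum_(i <- r | Q i) a i * W i w).
Proof.
move=> cW; elim: r => [|i r IH].
  rewrite (_ : (fun w => _) = fun=> 0); first exact: centered0.
  by apply/funext => w; rewrite big_nil.
rewrite (_ : (fun w => _) = if Q i then
    fun w => a i * W i w + \sum_(j <- r | Q j) a j * W j w
  else fun w => \sum_(j <- r | Q j) a j * W j w).
  by case: ifP => // _; apply: centeredD => //; exact: centeredZ.
by apply/funext => w; rewrite big_cons; case: ifP.
Qed.

Lemma centeredB U V : centered U -> centered V -> centered (fun w => U w - V w).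
Proof.
move=> cU cV; rewrite (_ : (fun w => _) = fun w => U w + (-1) * V w).
  by apply: centeredD => //; exact: centeredZ.
by apply/funext => w; rewrite mulN1r.
Qed.

Lemma centered_cov_fin_num U V : centered U -> centered V ->
  covariance P U V \is a fin_num.
Proof.
move=> cU cV; have [[U2 _] [V2 _]] := (cU, cV).
by apply: covariance_fin_num (Lfun2_mul_Lfun1 U2 V2); exact: centered_Lfun1.
Qed.

Lemma cov_sym U V : cov P U V = cov P V U.
Proof. by rewrite /cov covarianceC. Qed.

Lemma covDl U V W : centered U -> centered V -> centered W ->
  cov P (fun w => U w + V w) W = cov P U W + cov P V W.
Proof.
move=> cU cV cW; rewrite /cov -[fun w => _]/(U \+ V) covarianceDl; last 3 first.
  by case: cU. by case: cV. by case: cW.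
by rewrite fineD ?centered_cov_fin_num.
Qed.

Lemma covZl a U W : centered U -> centered W ->
  cov P (fun w => a * U w) W = a * cov P U W.
Proof.
move=> cU cW; have [[U2 _] [W2 _]] := (cU, cW).
have [[U1 W1] UW1] := (centered_Lfun1 cU, centered_Lfun1 cW, Lfun2_mul_Lfun1 U2 W2).
by rewrite /cov scale_funE covarianceZl// fineM ?centered_cov_fin_num.
Qed.

Lemma covBl U V W : centered U -> centered V -> centered W ->
  cov P (fun w => U w - V w) W = cov P U W - cov P V W.
Proof.
move=> cU cV cW; rewrite -mulN1r -covZl// -covDl//; last exact: centeredZ.
by congr cov; apply/funext => w; rewrite mulN1r.
Qed.

Lemma cov_suml I (r : seq I) (Q : pred I) (a : I -> R) (W : I -> T -> R) V :
    (forall i, centered (W i)) -> centered V ->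
  cov P (fun w => \sum_(i <- r | Q i) a i * W i w) V =
  \sum_(i <- r | Q i) a i * cov P (W i) V.
Proof.
move=> cW cV; elim: r => [|i r IH].
  rewrite big_nil (_ : (fun w => _) = cst 0); first by rewrite /cov covariance_cst_l.
  by apply/funext => w; rewrite big_nil.
rewrite big_cons -IH; case: ifPn => Qi.
  rewrite -covZl// -covDl//; [|exact: centeredZ|exact: centered_sum].
  by congr cov; apply/funext => w; rewrite big_cons Qi.
by congr cov; apply/funext => w; rewrite big_cons (negbTE Qi).
Qed.

Lemma centered_cov_sqr W : centered W ->
  fine (expectation P (fun w => W w ^+ 2)) = cov P W W.
Proof.
case=> _ W0; rewrite /cov covariance.unlock W0; congr (fine (expectation _ _)).
by apply/funext => w; rewrite !fctE /= subr0 expr2.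
Qed.

Lemma cov_ge0 W : 0 <= cov P W W.
Proof. by rewrite /cov fine_ge0// variance_ge0. Qed.

End Covariance.

Section MultipleCorrelation.
Context {disp : measure_display} {T : measurableType disp} {R : realType}.
Context (P : probability T R) {n : nat} (X : 'I_n -> T -> R).
Hypothesis X_std : forall i, standardized P (X i).
Let C := covmx P X.
Let cX i : centered P (X i) := standardized_centered (X_std i).

Definition covvec (Y : T -> R) : 'cV[R]_n := \col_i cov P Y (X i).

Lemma covmx_sym : C^T = C.
Proof. by apply/matrixP => i j; rewrite !mxE cov_sym. Qed.

Lemma covmx_diag i : C i i = 1.
Proof. by rewrite mxE standardized_cov. Qed.

Lemma cov_lincomb_X (a : 'cV_n) j :
  cov P (fun w => \sum_i a i 0 * X i w) (X j) = (C *m a) j 0.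
Proof.
rewrite cov_suml// mxE; apply: eq_bigr => i _.
by rewrite mxE mulrC cov_sym.
Qed.

Lemma cov_lincomb_lincomb (a : 'cV_n) :
  cov P (fun w => \sum_i a i 0 * X i w) (fun w => \sum_i a i 0 * X i w) =
  dot a (C *m a).
Proof.
rewrite cov_suml//; last exact: centered_sum.
by apply: eq_bigr => i _; rewrite cov_sym cov_lincomb_X.
Qed.

(** The form is the variance of a linear combination. *)
Lemma covmx_psd : psd C.
Proof. by move=> a; rewrite -cov_lincomb_lincomb cov_ge0. Qed.

Section Target.
Variable Y : T -> R.
Hypothesis Y_std : standardized P Y.
Let cY : centered P Y := standardized_centered Y_std.
Let b := covvec Y.

Lemma cov_lincomb_target (a : 'cV_n) :
  cov P (fun w => \sum_i a i 0 * X i w) Y = dot a b.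
Proof. by rewrite cov_suml//; apply: eq_bigr => i _; rewrite mxE cov_sym. Qed.

Lemma sq_error_lincomb (a : 'cV_n) :
  fine (expectation P (fun w => (Y w - \sum_i a i 0 * X i w) ^+ 2)) = 1 - gain C b a.
Proof.
have cL : centered P (fun w => \sum_i a i 0 * X i w) by exact: centered_sum.
rewrite centered_cov_sqr; last exact: centeredB.
rewrite covBl//; last exact: centeredB.
rewrite ![cov P _ (fun w => Y w - _)]cov_sym !covBl//.
rewrite [cov P Y (fun w => \sum_i _)]cov_sym cov_lincomb_lincomb.
by rewrite cov_lincomb_target standardized_cov// /gain mulr2n; ring.
Qed.

Lemma mean_sq_error_supported S (a : 'cV_n) : supported S a ->
  mean_sq_error P X Y S (fun i => a i 0) = 1 - gain C b a.
Proof.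
move=> aS; rewrite -sq_error_lincomb /mean_sq_error; congr (fine (expectation _ _)).
apply/funext => w; congr ((_ - _) ^+ 2); rewrite big_mkcond/=; apply: eq_bigr => i _.
by case: ifPn => // /aS ->; rewrite mul0r.
Qed.

Lemma mean_sq_error_restrict S (a : 'I_n -> R) :
  mean_sq_error P X Y S a =
  mean_sq_error P X Y S (fun i => (\col_i if i \in S then a i else 0) i 0 : R).
Proof.
rewrite /mean_sq_error; congr (fine (expectation _ _)); apply/funext => w.
by congr ((_ - _) ^+ 2); apply: eq_bigr => i iS; rewrite mxE iS.
Qed.

Hypothesis C_unit : C \in unitmx.

(** Coefficients outside [S] do not enter the error and can be set to 0, so [gain_le_fit] bounds
    every error from below; [coef] attains the bound. *)
Lemma RsqE S : Rsq P X Y S = fit C b S.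
Proof.
have lower a : 1 - fit C b S <= mean_sq_error P X Y S a.
  rewrite mean_sq_error_restrict mean_sq_error_supported => [|i /negbTE iS].
    rewrite lerB//; apply: gain_le_fit => //.
    - exact: covmx_sym.
    - exact: covmx_psd.
    - by move=> i /negbTE iS; rewrite mxE iS.
  by rewrite mxE iS.
apply/eqP; rewrite /Rsq subr_eq addrC -subr_eq eq_sym eq_le; apply/andP; split.
  rewrite /fit -(mean_sq_error_supported (@coef_supported _ _ C b S)).
  apply: ge_inf; last by exists (fun i => coef C b S i 0).
  by exists (1 - fit C b S) => _ [a _ <-].
apply: lb_le_inf => [|_ [a _ <-]]; last exact: lower.
by exists (mean_sq_error P X Y S (fun=> 0)), (fun=> 0).
Qed.

(** Identifies the selection criterion of OMP with the residual vector used in the analysis of its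
    runs. *)
Lemma cov_residual S i :
  cov P (residual P X Y S) (X i) = (b - C *m coef C b S) i 0.
Proof.
have bS : covcol P X Y S = (incl_mx S)^T *m b.
  by apply/matrixP => l j; rewrite ord1 incl_mx_trmul !mxE.
rewrite /residual bS; set a := invmx _ *m _.
rewrite covBl//; last exact: centered_sum.
rewrite cov_suml// !mxE; congr (_ - _).
transitivity ((C *m (incl_mx S *m a)) i 0); last by rewrite mxE.
rewrite mulmxA mxE; apply: eq_bigr => l _.
by rewrite mul_incl_mx [C _ _]mxE mulrC cov_sym.
Qed.

End Target.
End MultipleCorrelation.

(** * Dictionary selection *)

Section DictionarySelection.
Context {disp : measure_display} {T : measurableType disp} {R : realType}.
Context (P : probability T R) {n s : nat}.
Variables (X : 'I_n -> T -> R) (Z : 'I_s -> T -> R) (k : nat).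
Hypothesis X_std : forall i, standardized P (X i).
Hypothesis Z_std : forall j, standardized P (Z j).
Hypothesis C_unit : covmx P X \in unitmx.
Hypotheses (s_gt0 : (0 < s)%N) (k_gt0 : (0 < k)%N) (k_le_n : (k <= n)%N).
Implicit Types (D A S : {set 'I_n}).

Let C := covmx P X.
Let b j := covvec P X (Z j).
Let lmin := sparse_lambda_min C.
Let lmax := sparse_lambda_max C k.
Let g := gamma P X Z k.
Let symC : C^T = C := covmx_sym P X.
Let psdC : psd C := covmx_psd X_std.
Let diagC : forall i, C i i = 1 := covmx_diag X_std.

Lemma lmax_ge1 : 1 <= lmax.
Proof.
have i : 'I_n by exact: Ordinal (leq_trans k_gt0 k_le_n).
by rewrite -(diagC i) diag_le_sparse_lambda_max// k_gt0.
Qed.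

Lemma lmin_le1 m : (0 < m)%N -> lmin m <= 1.
Proof.
have i : 'I_n by exact: Ordinal (leq_trans k_gt0 k_le_n).
by move=> m0; rewrite -(diagC i) sparse_lambda_min_le_diag.
Qed.

Lemma submod_ratioE j S : submod_ratio P X (Z j) S =
  if (weight (b j) S == 0) && (fit C (b j) S == 0) then 1
  else weight (b j) S / fit C (b j) S.
Proof.
rewrite /submod_ratio (RsqE X_std (Z_std j) C_unit) -/C -/(b j).
have -> : \sum_(i in S) Rsq P X (Z j) [set i]%SET = weight (b j) S.
  by apply: eq_bigr => i _; rewrite (RsqE X_std (Z_std j) C_unit) fit_set1.
by [].
Qed.

Lemma lmin_le_submod_ratio j S : (#|S| <= k)%N -> lmin k <= submod_ratio P X (Z j) S.
Proof.
move=> Sk; rewrite submod_ratioE; have [f0|f0] := eqVneq (fit C (b j) S) 0.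
  (* Zero fit forces zero weight, so the ratio is 1 by the convention for [0/0]. *)
  have := weight_le_sparse_lambda_max_fit symC psdC C_unit (b j) (S := S) (m := k).
  rewrite f0 mulr0 Sk k_le_n => /(_ isT (lt_le_trans ltr01 lmax_ge1)) w0.
  by rewrite (_ : weight _ _ == 0) ?lmin_le1// eq_le w0 weight_ge0.
rewrite andbF ler_pdivlMr ?lt_def ?f0 ?fit_ge0//.
exact: sparse_lambda_min_fit_le.
Qed.

Lemma lmin_le_gamma : lmin k <= g.
Proof.
apply: (@le_inf_fin_image _ _ _ _ (Ordinal s_gt0)) => // j _.
apply: (@le_inf_fin_image _ _ _ _ finset.set0) => [|S Sk]; first by rewrite /= cards0.
exact: lmin_le_submod_ratio.
Qed.

Lemma gamma_ge0 : 0 <= g.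
Proof. by apply: le_trans lmin_le_gamma; exact: sparse_lambda_min_ge0. Qed.

Lemma gamma_le_submod_ratio j S : (#|S| <= k)%N -> g <= submod_ratio P X (Z j) S.
Proof.
move=> Sk; apply: (@le_trans _ _ (gamma_target P X (Z j) k)).
  exact: (@inf_fin_image_le _ _ _ (fun j => gamma_target P X (Z j) k)).
exact: inf_fin_image_le.
Qed.

(** The empty set has ratio [0/0 = 1]. *)
Lemma gamma_le1 : g <= 1.
Proof.
have := @gamma_le_submod_ratio (Ordinal s_gt0) finset.set0.
rewrite cards0 => /(_ isT); rewrite submod_ratioE fit_set0 //.
by rewrite /weight big_set0 eqxx.
Qed.

Lemma gamma_fit_le j S : (#|S| <= k)%N -> g * fit C (b j) S <= weight (b j) S.
Proof.
move=> Sk; have := gamma_le_submod_ratio j Sk; rewrite submod_ratioE.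
have [->|f0] := eqVneq (fit C (b j) S) 0; first by rewrite mulr0 weight_ge0.
by rewrite andbF ler_pdivlMr ?lt_def ?f0 ?fit_ge0.
Qed.

Definition top_weight D : R := \sum_j heaviest (fun i => b j i 0 ^+ 2) k D.

Let sqr_b_ge0 j i : 0 <= b j i 0 ^+ 2 := sqr_ge0 (b j i 0).

Lemma top_weight_ge0 D : 0 <= top_weight D.
Proof. by apply: sumr_ge0 => j _; exact: heaviest_ge0. Qed.

Lemma top_weight_mono D D' : D \subset D' -> top_weight D <= top_weight D'.
Proof. by move=> DD'; apply: ler_sum => j _; exact: heaviest_mono. Qed.

Lemma top_weight_gap D A :
  top_weight A - top_weight D <= \sum_(m in A) (top_weight (m |: D) - top_weight D).
Proof.
rewrite -sumrB; under [leRHS]eq_bigr do rewrite -sumrB.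
by rewrite exchange_big/=; apply: ler_sum => j _; exact: heaviest_gap.
Qed.

Lemma selectable_exists D A : A \subset D -> (#|A| <= k)%N ->
  exists2 S, selectable k D S & A \subset S.
Proof.
move=> AD Ak; rewrite /selectable; case: (leqP k #|D|) => kD; last first.
  by exists A => //; rewrite AD Ak.
have [|S [AS SD Sk]] := @exists_superset_card _ A D k AD; first by rewrite Ak.
by exists S => //; rewrite SD Sk eqxx.
Qed.

Lemma selectable_sub_card D S : selectable k D S -> S \subset D /\ (#|S| <= k)%N.
Proof. by case/andP => -> ; case: ifP => // _ /eqP ->. Qed.

Lemma fit_le_F D (S : 'I_s -> {set 'I_n}) : (forall j, selectable k D (S j)) ->
  \sum_j fit C (b j) (S j) <= F P X Z k D.
Proof.
move=> selS; apply: ler_sum => j _; rewrite -(RsqE X_std (Z_std j) C_unit).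
exact: (@le_sup_fin_image _ _ [set S | selectable k D S]%classic
  (Rsq P X (Z j)) _ (selS j)).
Qed.

Lemma F_attained D : exists S : 'I_s -> {set 'I_n},
  (forall j, selectable k D (S j)) /\ F P X Z k D = \sum_j fit C (b j) (S j).
Proof.
have [|S0 sel0 _] := @selectable_exists D finset.set0 (finset.sub0set D).
  by rewrite cards0.
have /choice[S SP] : forall j, exists S, selectable k D S /\
    sup [set Rsq P X (Z j) S | S in [set S | selectable k D S]]%classic = fit C (b j) S.
  move=> j; have [S selS ->] := @sup_fin_image_attained _ _
    [set S | selectable k D S]%classic (Rsq P X (Z j)) S0 sel0.
  by exists S; split=> //; rewrite (RsqE X_std (Z_std j) C_unit).
exists S; split=> [j|]; first by case: (SP j).
by apply: eq_bigr => j _; case: (SP j).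
Qed.

Lemma F_ge0 D : 0 <= F P X Z k D.
Proof.
have [S [_ ->]] := F_attained D; apply: sumr_ge0 => j _; exact: fit_ge0.
Qed.

Lemma top_weight_le_F D : top_weight D <= lmax * F P X Z k D.
Proof.
have /choice[S SP] : forall j, exists S, selectable k D S /\
    heaviest (fun i => b j i 0 ^+ 2) k D <= lmax * fit C (b j) S.
  move=> j; have [A [AD Ak ->]] := heaviest_attained (fun i => b j i 0 ^+ 2) k D.
  have [S selS AS] := selectable_exists AD Ak; exists S; split => //.
  apply: le_trans (weight_le_sparse_lambda_max_fit symC psdC C_unit (m := k) _ _ _) _.
  - by rewrite Ak.
  - exact: lt_le_trans ltr01 lmax_ge1.
  - by rewrite ler_wpM2l ?(le_trans ler01 lmax_ge1)//; exact: fit_mono.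
apply: le_trans (ler_wpM2l (le_trans ler01 lmax_ge1) (@fit_le_F D S _)); last first.
  by move=> j; case: (SP j).
by rewrite mulr_sumr; apply: ler_sum => j _; case: (SP j).
Qed.

Lemma gamma_F_le_top_weight D : g * F P X Z k D <= top_weight D.
Proof.
have [S [selS ->]] := F_attained D; rewrite mulr_sumr; apply: ler_sum => j _.
have [SD Sk] := selectable_sub_card (selS j).
by apply: le_trans (gamma_fit_le j Sk) _; exact: le_heaviest.
Qed.

Section Run.
Variables (omp : {set 'I_n} -> 'I_s -> {set 'I_n}).
Hypothesis ompP : forall A j, omp_output P X A (Z j) k (omp A j).

Let ompF D := \sum_j fit C (b j) (omp D j).
Let eta : R := 1 - expR (- lmin (2 * k) ^+ 2).

Lemma omp_run_exists D j : exists Sq : nat -> {set 'I_n},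
  [/\ Sq 0 = finset.set0, omp D j = Sq (minn k #|D|) &
   forall i, (i < minn k #|D|)%N -> exists m,
     let c := b j - C *m coef C (b j) (Sq i) in
     [/\ m \in D :\: Sq i,
         (forall m', m' \in D :\: Sq i -> `|c m' 0| <= `|c m 0|)
       & Sq i.+1 = m |: Sq i]].
Proof.
have [Sq [Sq0 SqS ->]] := ompP D j; exists Sq; split => // i /SqS[m [mD mmax ->]].
exists m; split => // m' /mmax.
by rewrite !(cov_residual X_std (Z_std j)).
Qed.

Lemma ompF_le_F D : ompF D <= F P X Z k D.
Proof.
apply: fit_le_F => j; have [Sq [Sq0 -> SqS]] := omp_run_exists D j.
have [SD cS] := omp_run_sub_card Sq0 SqS (leqnn _); rewrite /selectable SD cS/=.
by case: leqP => // /ltnW.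
Qed.

Lemma F_le_ompF D : eta * F P X Z k D <= ompF D.
Proof.
have [S [selS ->]] := F_attained D; rewrite mulr_sumr; apply: ler_sum => j _.
have [Sq [Sq0 -> SqS]] := omp_run_exists D j.
have [SD Sk] := selectable_sub_card (selS j).
exact: (omp_run_guarantee symC psdC C_unit diagC k_gt0 Sq0 SqS SD Sk).
Qed.

Lemma eta_ge0 : 0 <= eta.
Proof. by rewrite subr_ge0 -expR0 ler_expR oppr_le0 sqr_ge0. Qed.

Let x := lmax^-1 * eta * g.

(** For [m] outside [D] the chain is [x F^(m |: D) <= gamma eta F(m |: D) <= gamma F~(m |: D) <=
    gamma F~(D') <= gamma F(D') <= F^(D')]. *)
Lemma sds_omp_step_gain D D' m : sds_omp_step P X Z omp D D' ->
  x * top_weight (m |: D) <= top_weight D'.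
Proof.
move=> [m0 [m0D m0max ->]].
have x0 : 0 <= x.
  by rewrite !mulr_ge0 ?eta_ge0 ?gamma_ge0 ?invr_ge0// (le_trans ler01 lmax_ge1).
have step m' : m' \notin D -> x * top_weight (m' |: D) <= top_weight (m0 |: D).
  move=> m'D; apply: le_trans (gamma_F_le_top_weight _).
  apply: (@le_trans _ _ (g * (eta * F P X Z k (m' |: D)))).
    have -> : x * top_weight (m' |: D) = g * (eta * (lmax^-1 * top_weight (m' |: D))).
      by rewrite /x; ring.
    rewrite !ler_wpM2l ?gamma_ge0 ?eta_ge0//.
    rewrite ler_pdivrMl ?(lt_le_trans ltr01 lmax_ge1)//.
    exact: top_weight_le_F.
  rewrite ler_wpM2l ?gamma_ge0//; apply: le_trans (F_le_ompF _) _.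
  apply: le_trans (ompF_le_F _).
  have := m0max m' m'D.
  by under eq_bigr do rewrite (RsqE X_std (Z_std _) C_unit);
     under [X in _ <= X]eq_bigr do rewrite (RsqE X_std (Z_std _) C_unit).
(* If [m] is already in [D], then [m |: D] lies inside [m0 |: D], and monotonicity applies. *)
have [mD|] := boolP (m \in D); last exact: step.
apply: le_trans (step _ m0D); rewrite ler_wpM2l//; apply: top_weight_mono.
by rewrite finset.subUset finset.sub1set finset.subsetUr
  (fintype.subsetP (finset.subsetUr _ _)).
Qed.

Lemma top_weight_run d Dq A : (2 <= d)%N -> (#|A| <= d)%N -> Dq 0 = finset.set0 ->
    (forall i, (i < d)%N -> sds_omp_step P X Z omp (Dq i) (Dq i.+1)) ->
  top_weight A * ((1 - expR (- x)) / (d%:R - d%:R * x + 1)) <= top_weight (Dq d).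
Proof.
move=> d2 Ad Dq0 DqS.
have L0 := lt_le_trans ltr01 lmax_ge1.
have eta1 : eta <= 1 by rewrite gerBl expR_ge0.
have x01 : 0 <= x <= 1.
  rewrite !mulr_ge0 ?eta_ge0 ?gamma_ge0 ?invr_ge0 ?(ltW L0)//=.
  by rewrite !mulr_ile1 ?mulr_ge0 ?eta_ge0 ?gamma_ge0 ?invr_ge0 ?(ltW L0)
    ?gamma_le1// invf_le1 ?lmax_ge1.
apply: (greedy_recursion d2 x01 (top_weight_ge0 A)
  (f := fun i => top_weight (Dq i))) => [|i id]; first exact: top_weight_ge0.
have /andP[x0 x1] := x01; have gain_m m := sds_omp_step_gain m (DqS i id).
(* [A] may have fewer than [d] elements; nonnegativity allows [#|A|] to be replaced by [d]. *)
have mono_step : 0 <= top_weight (Dq i.+1) - x * top_weight (Dq i).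
  have [m [mD _ DqE]] := DqS i id; rewrite subr_ge0.
  apply: (@le_trans _ _ (top_weight (Dq i))); first by rewrite ler_piMl ?top_weight_ge0.
  by rewrite DqE top_weight_mono// finset.subsetUr.
apply: (@le_trans _ _ (#|A|%:R * (top_weight (Dq i.+1) - x * top_weight (Dq i)))).
  apply: le_trans (ler_wpM2l x0 (top_weight_gap (Dq i) A)) _.
  rewrite mulr_natl -sumr_const mulr_sumr; apply: ler_sum => m _.
  by rewrite mulrBr lerD2r.
by rewrite ler_wpM2r// ler_nat.
Qed.

End Run.
End DictionarySelection.

(** * Combination of the three estimates with the greedy recursion *)

Theorem theorem4p5 (disp : measure_display) (T : measurableType disp)
    (R : realType) (P : probability T R) (n s k d : nat)
    (X : 'I_n -> {RV P >-> R}) (Z : 'I_s -> {RV P >-> R})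
    (Dopt Domp : {set 'I_n})
    (s_gt0 : (0 < s)%N)
    (X_std : forall i, standardized P (X i))
    (Z_std : forall j, standardized P (Z j))
    (C_nonsing : covmx P X \in unitmx)
    (k_gt0 : (1 <= k)%N) (k_lt_d : (k < d)%N) (d_le_n : (d <= n)%N)
    (Domp_output : sds_omp_output P X Z k d Domp)
    (Dopt_optimal : optimal_dictionary P X Z k d Dopt) :
  let C := covmx P X in
  let g := gamma P X Z k in
  let lmin m := sparse_lambda_min C m in
  let lmax m := sparse_lambda_max C m in
  let p := (lmax k)^-1 * (1 - expR (- (lmin (2 * k)%N ^+ 2))) in
  let q := (1 - expR (- (p * g))) / (d%:R - d%:R * p * g + 1) in
  F P X Z k Domp >= F P X Z k Dopt * (g / lmax k) * q /\
  F P X Z k Dopt * (g / lmax k) * q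
    >= F P X Z k Dopt * (lmin k / lmax k) * q.
Proof.
move=> C g lmin lmax p q.
have k_le_n : (k <= n)%N by exact: leq_trans (ltnW k_lt_d) d_le_n.
have L1 : 1 <= lmax k by apply: lmax_ge1.
have L0 := lt_le_trans ltr01 L1.
have g0 : 0 <= g by apply: gamma_ge0.
have g1 : g <= 1 by apply: gamma_le1.
have lg : lmin k <= g by apply: lmin_le_gamma.
have F0 : 0 <= F P X Z k Dopt by apply: F_ge0.
have eta0 : 0 <= 1 - expR (- lmin (2 * k)%N ^+ 2) by apply: eta_ge0.
have eta1 : 1 - expR (- lmin (2 * k)%N ^+ 2) <= 1 by rewrite gerBl expR_ge0.
have p0 : 0 <= p by rewrite mulr_ge0// invr_ge0 ltW.
have p1 : p <= 1 by rewrite mulr_ile1 ?invr_ge0 ?(ltW L0)// invf_le1.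
have pg1 : p * g <= 1 by rewrite mulr_ile1.
have q0 : 0 <= q.
  apply: divr_ge0; first by rewrite subr_ge0 -expR0 ler_expR oppr_le0 mulr_ge0.
  rewrite addr_ge0// -mulrA -[X in X - _]mulr1 -mulrBr mulr_ge0 ?ler0n// subr_ge0//.
split; last first.
  by rewrite ler_wpM2r// ler_wpM2l// ler_wpM2r ?invr_ge0// ltW.
have [omp [Dq [ompP Dq0 DqS ->]]] := Domp_output.
have [Dopt_d _] := Dopt_optimal.
have d2 : (2 <= d)%N by exact: leq_ltn_trans k_lt_d.
have run : top_weight P X Z k Dopt * q <= top_weight P X Z k (Dq d).
  by rewrite /q -[d%:R * p * g]mulrA; apply: top_weight_run DqS.
have upper : top_weight P X Z k (Dq d) <= lmax k * F P X Z k (Dq d).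
  by apply: top_weight_le_F.
have lower : g * F P X Z k Dopt <= top_weight P X Z k Dopt.
  by apply: gamma_F_le_top_weight.
(* Multiplied by [lmax k], the claim is the chain [gamma F(Dopt) q <= F^(Dopt) q <= F^(Domp) <= lmax
   F(Domp)]. *)
rewrite -(ler_pM2l L0); apply: le_trans upper; apply: le_trans run.
rewrite [lmax k * _]mulrA ler_wpM2r// mulrCA [lmax k * _]mulrC divfK ?gt_eqF//.
by rewrite mulrC.
Qed.
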